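(* Let $s$ be a positive integer with $s\neq 5$. Then for no non-negative integers $k,l,m$ does there exist a dessin d'enfant of genus $0$ with passport $(3^k\,|\,2^l\,|\,5^m\,s^1)$, i.e. a dessin d'enfant on the sphere with $k$ black vertices, all of degree $3$, $l$ white vertices, all of degree $2$, and $m+1$ faces, of which $m$ have degree $5$ and one has degree $s$.
   Context: A dessin d'enfant is a finite bicolored graph $\Gamma$ (vertices are colored black and white, every edge joins a black vertex to a white vertex; multiple edges are allowed) embedded into a compact connected oriented surface $X$ in such a way that $X\setminus\Gamma$ is homeomorphic to a disjoint union of open discs; these discs are called the faces of the dessin. The genus of the dessin is the genus of $X$. The degree of a face is half the number of edges in its boundary walk, edges being counted with multiplicity (an edge having the same face on both sides is counted twice). Let $n$ be the number of edges of the dessin. The passport of the dessin is the triple of partitions of $n$ given by the degrees of the black vertices, the degrees of the white vertices, and the degrees of the faces. The notation $a^i\,b^j$ stands for the partition with $i$ parts equal to $a$ and $j$ parts equal to $b$. Equivalently, dessins of genus $0$ with $n$ edges correspond to Belyi functions of degree $n$ on the Riemann sphere $\mathbf{P}_1(\mathbb{C})$, i.e. non-constant rational functions $\beta$ whose critical values lie in $\{0,1,\infty\}$. The dessin of $\beta$ is the graph $\beta^{-1}([0,1])$ with black vertices $\beta^{-1}(0)$ and white vertices $\beta^{-1}(1)$, and its passport is the triple of partitions of $n$ given by the multiplicities of the preimages of $0$, $1$, $\infty$ respectively. *)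

(* Defs.v *)
From HB Require Import structures.
From mathcomp Require Import all_boot all_order all_algebra all_fingroup.
From mathcomp Require Import reals complex.

Set Implicit Arguments.
Unset Strict Implicit.
Unset Printing Implicit Defensive.

Import GRing.Theory Num.Theory.

Local Open Scope ring_scope.

(* A connected bicolored multigraph cellularly embedded into a compact oriented
   surface is encoded by the graph together with its rotation system: around
   each vertex, the orientation of the surface induces a cyclic order on the
   incident edges, and this data determines the embedding up to an
   orientation-preserving homeomorphism.  The graph reduced to one isolated
   vertex is excluded: it has no edge and its only face would have degree 0. *)
Record dessin := Dessin {
  black : finType;
  white : finType;
  edge : finType;
  black_end : edge -> black;
  white_end : edge -> white;
  black_rot : {perm edge};
  white_rot : {perm edge};
  black_rotP : forall e f : edge,
    (f \in porbit black_rot e) = (black_end f == black_end e);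
  white_rotP : forall e f : edge,
    (f \in porbit white_rot e) = (white_end f == white_end e);
  edge_gt0 : (0 < #|edge|)%N;
  dessin_connected : forall u v : black + white,
    connect (fun x y => [exists e : edge,
       ((x == inl (black_end e)) && (y == inr (white_end e)))
    || ((x == inr (white_end e)) && (y == inl (black_end e)))]) u v
}.

Section DessinInvariants.
Variable D : dessin.

Definition black_degree (b : black D) : nat := #|[set e | black_end e == b]|.
Definition white_degree (w : white D) : nat := #|[set e | white_end e == w]|.

(* A boundary walk follows an edge e from black to white, continues from white
   to black along the next edge white_rot e, then along
   black_rot (white_rot e), etc.  (Permutations compose from left to right.)
   Each side of an edge is walked along once, in opposite directions, and a
   cycle of face_walk lists the edges of one boundary walk which are followed
   from black to white: its size is half the length of the walk. *)
Definition face_walk : {perm edge D} := (white_rot D * black_rot D)%g.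
Definition faces : {set {set edge D}} := porbits face_walk.

Definition euler_char : int :=
  (#|black D| + #|white D|)%:Z - #|edge D|%:Z + #|faces|%:Z.

Definition has_genus (g : nat) : Prop := euler_char = 2 - 2 * g%:Z.

(* A partition is given by the sequence of its parts, in any order. *)
Definition has_passport (pb pw pf : seq nat) : Prop :=
  [/\ perm_eq [seq black_degree b | b <- enum (black D)] pb,
      perm_eq [seq white_degree w | w <- enum (white D)] pw
    & perm_eq [seq #|F| | F : {set edge D} <- enum faces] pf].

End DessinInvariants.

(* The projective line over K; None is the point at infinity. *)
Definition P1 (K : Type) := option K.

Record ratfun (K : fieldType) := RatFun {
  num : {poly K};
  den : {poly K};
  den_neq0 : den != 0;
  num_den_coprime : coprimep num den
}.

Section RatFun.
Variables (K : fieldType) (f : ratfun K).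

Definition ratfun_degree : nat := maxn (size (num f)).-1 (size (den f)).-1.

(* The point [a : b] of the projective line. *)
Definition mkP1 (a b : K) : P1 K := if b == 0 then None else Some (a / b).

(* At infinity, the homogenizations of num and den in degree ratfun_degree take
   as values the coefficients of that degree. *)
Definition ratfun_eval (x : P1 K) : P1 K :=
  match x with
  | Some z => mkP1 (num f).[z] (den f).[z]
  | None => mkP1 (num f)`_ratfun_degree (den f)`_ratfun_degree
  end.

(* A polynomial whose homogenization in degree ratfun_degree has the fiber over
   v as zero locus, with multiplicities. *)
Definition fiber_poly (v : P1 K) : {poly K} :=
  match v with
  | Some c => num f - c *: den f
  | None => den f
  end.

(* The local degree of f at x. *)
Definition ratfun_mult (x : P1 K) : nat :=
  let p := fiber_poly (ratfun_eval x) in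
  match x with
  | Some z => mup z p
  | None => (ratfun_degree - (size p).-1)%N
  end.

Definition critical_value (v : P1 K) : Prop :=
  exists2 x, ratfun_eval x = v & (1 < ratfun_mult x)%N.

Definition belyi : Prop :=
  (0 < ratfun_degree)%N /\
  forall v, critical_value v -> [\/ v = Some 0, v = Some 1 | v = None].

Definition fiber_partition (v : P1 K) (p : seq nat) : Prop :=
  exists s : seq (P1 K),
    [/\ uniq s, forall x, x \in s <-> ratfun_eval x = v
      & perm_eq [seq ratfun_mult x | x <- s] p].

Definition belyi_passport (p0 p1 pinf : seq nat) : Prop :=
  [/\ fiber_partition (Some 0) p0, fiber_partition (Some 1) p1
    & fiber_partition None pinf].

End RatFun.

(* Main.v *)
Require Import Defs.
From mathcomp Require Import all_boot all_order all_algebra all_fingroup.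
From mathcomp Require Import separable.
From mathcomp Require Import reals complex.
From mathcomp Require Import zify ring.

Set Implicit Arguments.
Unset Strict Implicit.
Unset Printing Implicit Defensive.

Import GRing.Theory Num.Theory.

(** The rotation group of the icosahedron is generated by rotations a, b of
    orders 3 and 2 whose product z has order 5, and the quotient map of the
    sphere by this group is branched over three points with orders 3, 2, 5.
    A planar dessin all of whose black vertices, white vertices and faces but
    one have degrees 3, 2 and 5 becomes simply connected once the centre of the
    exceptional face is removed, so its Belyi function lifts through this
    quotient map to a developing map.  The latter extends to a self-map of the
    sphere ramified over at most one point, hence of degree 1 by the
    Riemann-Hurwitz formula, and s = 5.  Dessins and rational functions are
    treated separately, each by an elementary substitute for the developing
    map.

    For dessins, the substitute is an equivariant map from the n edges to the
    twelve vertices of the icosahedron.  Let the rotations of the dessin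
    around black and white vertices act on the pairs (edge, vertex) together
    with a and b.  This is a covering of degree 12 of the dessin, branched over the exceptional face only, and
    [euler_inequality] (no component of a hypermap has an Euler characteristic
    above 2) leaves it no choice but to fall apart into twelve copies of the
    dessin.  Such a copy is the graph of an equivariant map
    ([icosahedral_map]).  Around the exceptional face it shows that z ^ s = 1,
    so that 5 divides s; if it sends an edge of that face to a vertex fixed by
    z, then all the s edges of the face go there, and as its fibers have the
    same size, 12 s <= n.  The Euler characteristic gives n = 30 + 6 s, whence
    s <= 5.

    For a Belyi function, a change of coordinate moves the exceptional pole to
    infinity.  Up to constants, the function is A^3 / C^5 and differs from 1 by
    B^2 / C^5, where A, B and C have simple roots.  Were the developing map
    known to exist, A, B and C would be Klein's invariant forms of degrees 20,
    30 and 12 evaluated at two solutions of a differential equation y'' = q y,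
    where q is a Schwarzian derivative: it has no pole at finite distance, as
    the orders of ramification are the right ones there, and vanishes at
    infinity, hence q = 0.  The resulting relation, that A is proportional to
    the Hessian 12 C C'' - 11 C'^2 of C, can be derived directly from
    A^3 - B^2 = kappa C^5 by divisibility and a comparison of degrees
    ([hessian_relation]); its leading coefficients contain s and are compatible
    only if s = 5 ([pole_order_eq5]). *)

(** * The Euler inequality for pairs of permutations *)

Section EulerInequality.
Local Open Scope group_scope.

Lemma leq_card_porbits (T : finType) (x : {perm T}) : #|porbits x| <= #|T|.
Proof. exact: leq_imset_card. Qed.

(** The map [f] is a labelling of the orbits of the group generated by [x] and
    [y], so the bound says that each orbit has a nonnegative genus.  A labelling
    with sufficiently many labels is easier to carry through the induction than
    the set of orbits.  The induction splits a cycle of [x] by a transposition: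
    either this splits a cycle of [x * y] as well, and the two changes in the
    number of cycles cancel, or it merges two cycles of [x * y] and then at most
    two labels have to be identified. *)
Lemma euler_inequality (T : finType) (x y : {perm T}) :
  exists f : T -> {set T},
    [/\ forall t, f (x t) = f t, forall t, f (y t) = f t
      & #|porbits x| + #|porbits y| + #|porbits (x * y)|
          <= #|T| + #|f @: T|.*2].
Proof.
elim: {x}_.+1 {-2}x (ltnSn (#|T| - #|porbits x|)) => // c IHc x.
have [/forallP fix_x|] := boolP [forall t, x t == t].
  move=> _; exists (porbit y).
  have -> : x = 1 by apply/permP => t; rewrite perm1; apply/eqP.
  split=> [t|t|]; first by rewrite perm1.
    by rewrite -[in LHS](expg1 y) porbit_perm.
  by rewrite mul1g; have := leq_card_porbits (1 : {perm T}); rewrite /porbits; lia.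
rewrite negb_forall => /existsP[i xi_neq_i] lt_c.
pose t := tperm i (x i); pose x' := t * x.
have Dx : x = t * x' by rewrite mulgA tperm2 mul1g.
have card_x' : #|porbits x'| = #|porbits x|.+1.
  have := porbits_mul_tperm x i (x i).
  have -> : i \in porbit x (x i) by rewrite porbit_sym -{1}[x]expg1 mem_porbit.
  by rewrite /= [i == _]eq_sym xi_neq_i addn0 addn1.
have [|f [fx' fy card_f]] := IHc x'.
  by have := leq_card_porbits x'; lia.
have fx'y u : f ((x' * y) u) = f u by rewrite permM fy fx'.
have f_orbit u v : u \in porbit (x' * y) v -> f u = f v.
  case/porbitP=> r ->; elim: r => [|r IHr]; first by rewrite expg0 perm1.
  by rewrite expgSr permM fx'y.
have fx u : f (x u) = f (t u) by rewrite {1}Dx permM fx'.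
have := porbits_mul_tperm (x' * y) i (x i).
rewrite /= mulgA -/t -Dx [i == _]eq_sym xi_neq_i.
case: (boolP (i \in porbit (x' * y) (x i))) => [/f_orbit f_i | _] card_xy.
  exists f; split=> // [u|]; last first.
    by move: card_xy card_f; rewrite card_x' addn0 addn1 => ->; rewrite addnS !addSn.
  by rewrite fx /t; case: tpermP => // ->.
(* Two cycles are merged: the label of [i] is replaced by that of [x i]. *)
exists (fun u => if f u == f i then f (x i) else f u); split=> [u|u|].
- by rewrite fx /t; case: tpermP => [->|->|//]; rewrite eqxx; case: ifP.
- by rewrite fy.
rewrite card_x' in card_f.
have arith (a b q p n d e : nat) : q <= p.+1 -> a + 2 = b + 1 ->
  d.+1 + e + b <= n + q.*2 -> d + e + a <= n + p.*2 by lia.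
apply: arith card_xy card_f; set g := fun u => _.
have /subset_leq_card : f @: T \subset f i |: g @: T.
  apply/subsetP=> _ /imsetP[u _ ->]; rewrite in_setU1 /g.
  by case: eqP => //= /eqP/negPf fu; apply/imsetP; exists u => //; rewrite fu.
by rewrite cardsU1; case: (_ \notin _) => // /leqW.
Qed.

Lemma card_porbit_le (T : finType) (x : {perm T}) r t :
  0 < r -> (x ^+ r) t = t -> #|porbit x t| <= r.
Proof.
move=> r_gt0 xrt.
have sub : porbit x t \subset [set (x ^+ (i : 'I_r)) t | i in 'I_r].
  apply/subsetP=> _ /porbitP[j ->]; apply/imsetP.
  exists (Ordinal (ltn_pmod j r_gt0)) => //=.
  rewrite [in LHS](divn_eq j r) mulnC expgD permM expgM.
  congr ((_ : {perm T}) _); elim: (j %/ r) => [|q IHq].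
    by rewrite expg0 perm1.
  by rewrite expgSr permM IHq.
rewrite (leq_trans (subset_leq_card sub)) //.
by rewrite (leq_trans (leq_imset_card _ _)) // card_ord.
Qed.

Lemma card_porbits_ge (T : finType) (x : {perm T}) r (A : {set T}) :
  0 < r -> {in A, forall t, (x ^+ r) t = t} ->
  #|A| <= #|porbit x @: A| * r.
Proof.
move=> r_gt0 xr; apply: (@leq_trans #|cover (porbit x @: A)|).
  apply/subset_leq_card/subsetP=> t tA; apply/bigcupP.
  by exists (porbit x t); rewrite ?imset_f ?porbit_id.
apply: leq_trans (leq_card_cover _) _.
rewrite -sum_nat_const; apply: leq_sum => _ /imsetP[t tA ->].
exact/card_porbit_le/xr.
Qed.

Lemma card_le_porbits (T : finType) (x : {perm T}) r :
  0 < r -> (x ^+ r = 1)%g -> #|T| <= #|porbits x| * r.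
Proof.
move=> r_gt0 xr; rewrite -cardsT.
apply: (leq_trans (card_porbits_ge (x := x) r_gt0 _)) => [t _|].
  by rewrite xr perm1.
rewrite leq_mul2r subset_leq_card ?orbT //.
by apply/subsetP=> _ /imsetP[t _ ->]; exact: imset_f.
Qed.

Definition prod_perm (T U : finType) (x : {perm T}) (a : {perm U}) :
    {perm T * U} :=
  perm (bij_inj (@Bijective _ _ (fun p => (x p.1, a p.2))
    (fun p => (x^-1 p.1, a^-1 p.2))
    (fun '(t, u) => f_equal2 pair (permK x t) (permK a u))
    (fun '(t, u) => f_equal2 pair (permKV x t) (permKV a u)))).

Lemma prod_permE (T U : finType) (x : {perm T}) (a : {perm U}) t u :
  prod_perm x a (t, u) = (x t, a u).
Proof. by rewrite permE. Qed.

Lemma prod_permM (T U : finType) (x y : {perm T}) (a b : {perm U}) :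
  prod_perm x a * prod_perm y b = prod_perm (x * y) (a * b).
Proof. by apply/permP=> -[t u]; rewrite !(permM, prod_permE). Qed.

Lemma prod_permX (T U : finType) (x : {perm T}) (a : {perm U}) r :
  prod_perm x a ^+ r = prod_perm (x ^+ r) (a ^+ r).
Proof.
elim: r => [|r IHr]; last by rewrite !expgS IHr prod_permM.
by apply/permP=> -[t u]; rewrite prod_permE !expg0 !perm1.
Qed.
End EulerInequality.

(** * Rotations of the icosahedron acting on its vertices *)

Section Icosahedron.

Definition tabulated (s : seq nat) (i : 'I_12) : 'I_12 := inZp (nth 0 s i).

(** The vertices 0 and 11 are opposite, the neighbours of 0 are 1, ..., 5 in
    cyclic order and those of 11 are 6, ..., 10; moreover 1 is adjacent to 6 and
    7.  Then [tab_b] is the half-turn about the edge from 0 to 1, and [tab_a]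
    is a rotation about the face 0, 1, 2. *)
Definition tab_a := tabulated [:: 2; 0; 1; 7; 8; 3; 4; 5; 6; 11; 9; 10].
Definition tab_b := tabulated [:: 1; 0; 5; 6; 7; 2; 3; 4; 10; 11; 8; 9].

Lemma tab_a3 i : tab_a (tab_a (tab_a i)) = i.
Proof. by apply: val_inj; case: i; do 12![case=> //]. Qed.
Lemma tab_b2 i : tab_b (tab_b i) = i.
Proof. by apply: val_inj; case: i; do 12![case=> //]. Qed.

Local Open Scope group_scope.

Definition rot_a : {perm 'I_12} :=
  perm (@can_inj _ _ tab_a (fun i => tab_a (tab_a i)) tab_a3).
Definition rot_b : {perm 'I_12} := perm (@can_inj _ _ tab_b tab_b tab_b2).

Lemma rot_aE i : rot_a i = tab_a i. Proof. exact: permE. Qed.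

Lemma rot_bE i : rot_b i = tab_b i. Proof. exact: permE. Qed.

Lemma rot_a3 : rot_a ^+ 3 = 1.
Proof.
by apply/permP=> i; rewrite !expgS expg0 mulg1 !permM perm1 !rot_aE tab_a3.
Qed.

Lemma rot_b2 : rot_b ^+ 2 = 1.
Proof.
by apply/permP=> i; rewrite !expgS expg0 mulg1 !permM perm1 !rot_bE tab_b2.
Qed.

(** Permutations compose from left to right: [rot_z] is the rotation about the
    vertex 0 which maps 1 to 2. *)
Definition rot_z := rot_b * rot_a.

Lemma rot_zE i : rot_z i = tab_a (tab_b i).
Proof. by rewrite permM rot_aE rot_bE. Qed.

Lemma rot_z5 : rot_z ^+ 5 = 1.
Proof.
apply/permP=> i; rewrite !expgS expg0 mulg1 !permM perm1 !(rot_aE, rot_bE).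
by apply: val_inj; case: i; do 12![case=> //].
Qed.

Lemma rot_z0 : rot_z ord0 = ord0.
Proof. by rewrite rot_zE; apply: val_inj. Qed.

Lemma rot_z_order r : rot_z ^+ r = 1 -> 5 %| r.
Proof.
rewrite {1}(divn_eq r 5) mulnC expgD expgM rot_z5 expg1n mul1g /dvdn.
move/permP/(_ (inZp 1%N)); case: (r %% 5) (ltn_pmod r (isT : 0 < 5)) => //.
by do 4![case=> [_|]; first by
  rewrite !expgS expg0 !permM !perm1 !(rot_aE, rot_bE) => /(congr1 val)].
Qed.

Lemma icosahedron_transitive (P : pred 'I_12) :
  P ord0 -> (forall i, P i -> P (rot_a i)) -> (forall i, P i -> P (rot_b i)) ->
  forall i, P i.
Proof.
move=> P0 Pa Pb i.
(* The i-th word leads from the vertex 0 to the vertex i, its last letter being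
   applied first; [true] stands for [tab_a]. *)
pose words := [:: [::]; [:: false]; [:: true]; [:: true; false; true];
  [:: false; true; true; false; true]; [:: false; true];
  [:: false; true; false; true]; [:: true; true; false; true];
  [:: true; false; true; true; false; true];
  [:: true; false; true; false; true; true; false; true];
  [:: false; true; false; true; true; false; true];
  [:: true; true; false; true; false; true; true; false; true]].
pose act := foldr (fun c j => if c then tab_a j else tab_b j) ord0.
have -> : i = act (nth [::] words i).
  by apply: val_inj; case: i; do 12![case=> //].
elim: (nth _ _ _) => //= [[] w Pw].
  by have := Pa _ Pw; rewrite rot_aE.
by have := Pb _ Pw; rewrite rot_bE.
Qed.

End Icosahedron.

(** * The equivariant map to the icosahedron *)

Section IcosahedralMap.
Variables (E : finType) (x y : {perm E}) (e0 : E).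
Hypothesis xy_trans : forall (P : pred E) e1, P e1 ->
  (forall e, P e -> P (x e)) -> (forall e, P e -> P (y e)) -> forall e, P e.
Hypotheses (x3 : (x ^+ 3)%g = 1%g) (y2 : (y ^+ 2)%g = 1%g).
Let z := (y * x)%g.
Let F := porbit z e0.
Hypothesis z5 : {in ~: F, forall e, (z ^+ 5)%g e = e}.
Hypothesis genus0 : #|E| = 30 + 6 * #|F|.

(* [X] and [Y] define the covering of degree 12, and [W] walks along the faces. *)
Let X := prod_perm x rot_a.
Let Y := prod_perm y rot_b.

Let W := (Y * X)%g.
Let WE : W = prod_perm z rot_z. Proof. exact: prod_permM. Qed.

Let X3 : (X ^+ 3 = 1)%g.
Proof.
by rewrite prod_permX x3 rot_a3; apply/permP=> -[e i]; rewrite prod_permE !perm1.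
Qed.

Let Y2 : (Y ^+ 2 = 1)%g.
Proof.
by rewrite prod_permX y2 rot_b2; apply/permP=> -[e i]; rewrite prod_permE !perm1.
Qed.

Let card_T : #|{: E * 'I_12}| = #|E| * 12.
Proof. by rewrite card_prod card_ord. Qed.

Let card_X : #|E| * 12 <= #|porbits X| * 3.
Proof.
by rewrite -card_T card_le_porbits // X3.
Qed.

Let card_Y : #|E| * 12 <= #|porbits Y| * 2.
Proof.
by rewrite -card_T card_le_porbits // Y2.
Qed.

(* The faces of the covering above the exceptional face. *)
Let over_e0 := [set porbit W (e0, i) | i in 'I_12].

Let z_iter r e i : (W ^+ r)%g (e, i) = ((z ^+ r)%g e, (rot_z ^+ r)%g i).
Proof. by rewrite WE prod_permX prod_permE. Qed.

Let card_Z : (#|E| - #|F|) * 12 <= (#|porbits W| - #|over_e0|) * 5.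
Proof.
pose A := setX (~: F) [set: 'I_12].
have cardA : #|A| = (#|E| - #|F|) * 12.
  by rewrite cardsX cardsT card_ord cardsCs setCK.
have : #|A| <= #|porbit W @: A| * 5.
  apply: card_porbits_ge => // -[e i] /setXP[eF _].
  by rewrite z_iter z5 // rot_z5 perm1.
rewrite cardA => /leq_trans; apply; rewrite leq_mul2r /= leq_subRL; last first.
  by apply/subset_leq_card/subsetP=> _ /imsetP[i _ ->]; rewrite imset_f.
have disj : over_e0 :&: porbit W @: A = set0.
  apply/eqP; rewrite -subset0; apply/subsetP=> O /setIP[/imsetP[i _ ->]].
  case/imsetP=> -[e j] /setXP[eF _] /eqP; rewrite eq_porbit_mem => /porbitP[r].
  rewrite z_iter => -[De0 _]; case/setCP: eF.
  by rewrite porbit_sym; apply/porbitP; exists r.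
rewrite -cardsUI disj cards0 addn0; apply/subset_leq_card; rewrite subUset.
by apply/andP; split; apply/subsetP=> _ /imsetP[t _ ->]; rewrite imset_f.
Qed.

(** Let N be the number of labels given by the Euler inequality, and c the number
    of faces of the covering above the exceptional face.  As the other faces and
    the vertices of the dessin are unramified, the inequality reads
    12 + c <= 2 N.  By connectedness every label occurs above every edge, so that
    N <= c <= 12.  Hence N = 12, each label occurs exactly once above each edge,
    and a label is the graph of an equivariant map. *)
Lemma icosahedral_map :
  exists2 h : E -> 'I_12,
    [/\ forall e, h (x e) = rot_a (h e), forall e, h (y e) = rot_b (h e)
      & h e0 = ord0] & (rot_z ^+ #|F| = 1)%g.
Proof.
have [f [fY fX card_f]] := euler_inequality Y X.
have fx e i : f (x e, rot_a i) = f (e, i) by rewrite -[RHS]fX prod_permE.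
have fy e i : f (y e, rot_b i) = f (e, i) by rewrite -[RHS]fY prod_permE.
pose N := #|f @: {: E * 'I_12}|.
have f_everywhere e : {subset f @: {: E * 'I_12} <= (f \o pair e) @: 'I_12}.
  move=> _ /imsetP[[e1 i1] _ ->].
  suff H : forall e, f (e1, i1) \in codom (f \o pair e).
    by have /codomP[i ->] := H e; exact: imset_f.
  have step (P : pred E) : P = (fun e => f (e1, i1) \in codom (f \o pair e)) ->
      (forall e, P e -> P (x e)) /\ (forall e, P e -> P (y e)).
    move=> ->; split=> e2 /codomP[i ->] /=.
      by rewrite -fx; apply: (codom_f (f \o pair _)).
    by rewrite -fy; apply: (codom_f (f \o pair _)).
  have [Px Py] := step _ erefl.
  apply: (xy_trans (e1 := e1)) => //; exact: (codom_f (f \o pair _)).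
have fiber_e0 i j : porbit W (e0, i) = porbit W (e0, j) ->
  f (e0, i) = f (e0, j).
  move/eqP; rewrite eq_porbit_mem => /porbitP[r ->].
  elim: r => [|r IHr]; first by rewrite expg0 perm1.
  by rewrite expgSr permM permM fX fY.
have N_le_over : N <= #|over_e0|.
  pose g (O : {set E * 'I_12}) := f (odflt (e0, ord0) [pick t in O | t.1 == e0]).
  apply: (@leq_trans #|g @: over_e0|); last exact: leq_imset_card.
  apply/subset_leq_card/subsetP=> v /(f_everywhere e0)/imsetP[i _ ->].
  apply/imsetP; exists (porbit W (e0, i)); first exact: imset_f.
  rewrite /g; case: pickP => [[e j] /= /andP[tO /eqP De]|].
    by rewrite De in tO *; apply: fiber_e0; apply/eqP; rewrite eq_sym eq_porbit_mem.
  by move/(_ (e0, i)); rewrite porbit_id eqxx.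
have over_le : #|over_e0| <= 12.
  by rewrite (leq_trans (leq_imset_card _ _)) ?card_ord.
have N12 : 12 <= N.
  have over_sub : #|over_e0| <= #|porbits W|.
    by apply/subset_leq_card/subsetP=> _ /imsetP[i _ ->]; rewrite imset_f.
  have F_le : #|F| <= #|E| by rewrite max_card.
  move: card_X card_Y card_Z card_f; rewrite -/W card_T -/N.
  move: over_sub N_le_over over_le F_le; rewrite genus0.
  move: #|porbits X| #|porbits Y| #|porbits W| #|over_e0| #|F| N.
  clear; lia.
have f_inj e : injective (f \o pair e).
  apply/injectiveP; rewrite -[injectiveb _]/(uniq (codom (f \o pair e))).
  apply/card_uniqP; rewrite size_codom card_ord; apply/eqP.
  rewrite eqn_leq (leq_trans (card_size _)) ?size_codom ?card_ord //=.
  apply: leq_trans N12 _; apply: subset_leq_card; apply/subsetP=> v.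
  by case/(f_everywhere e)/imsetP=> i _ ->; exact: codom_f.
have f0 e : exists i, f (e, i) == f (e0, ord0).
  have /imsetP[i _ Di] := f_everywhere e _ (imset_f f (isT : (e0, ord0) \in predT)).
  by exists i; rewrite Di.
(* The label chosen is that of a vertex fixed by [rot_z], above [e0]. *)
exists (fun e => xchoose (f0 e)).
  have hP e i : f (e, i) = f (e0, ord0) -> xchoose (f0 e) = i.
    by have /eqP {1}<- := xchooseP (f0 e) => /(f_inj e).
  by split=> [e|e|]; apply: hP => //; rewrite (fx, fy); apply/eqP/(xchooseP (f0 e)).
apply/permP=> i; rewrite perm1; apply: (f_inj e0); rewrite /=.
apply/esym/fiber_e0/esym/eqP; rewrite eq_porbit_mem; apply/porbitP.
have zF : (z ^+ #|F|)%g e0 = e0 by rewrite permX; exact: iter_porbit.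
by exists #|F|; rewrite z_iter zF.
Qed.

(** The equivariant map is constant on the exceptional face, because its value at
    [e0] is fixed by [rot_z]; comparing this with the common size of the fibers
    bounds the degree of the face by 5. *)
Theorem icosahedral_rigidity : #|F| = 5.
Proof.
have [h [hx hy h0] zF] := icosahedral_map.
pose fib i := #|[set e | h e == i]|.
have fib_min i : fib ord0 <= fib i.
  have fib_le (w : {perm E}) (r : {perm 'I_12}) j :
      (forall e, h (w e) = r (h e)) -> fib j <= fib (r j).
    move=> hw; rewrite /fib -(card_imset [set e | h e == j] (@perm_inj _ w)).
    apply/subset_leq_card/subsetP=> _ /imsetP[e he ->].
    by move: he; rewrite !inE hw => /eqP ->.
  apply: (icosahedron_transitive (P := fun i => fib ord0 <= fib i)) => // j.
    by move=> le_j; apply: leq_trans le_j (fib_le _ _ _ hx).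
  by move=> le_j; apply: leq_trans le_j (fib_le _ _ _ hy).
have F_le : #|F| <= fib ord0.
  apply/subset_leq_card/subsetP=> _ /porbitP[r ->]; rewrite inE.
  elim: r => [|r IHr]; first by rewrite expg0 perm1 h0.
  by rewrite expgSr permM permM hx hy (eqP IHr) -permM rot_z0.
have : 12 * fib ord0 <= #|E|.
  rewrite -[X in _ <= X]cardsT -sum1_card (partition_big h predT) //=.
  apply: (@leq_trans (\sum_(i < 12) fib ord0)).
    by rewrite sum_nat_const card_ord.
  apply: leq_sum => i _; rewrite (leq_trans (fib_min i)) // /fib -sum1_card.
  by apply/eq_leq/eq_bigl=> e; rewrite !inE.
have F_gt0 : 0 < #|F| by apply/card_gt0P; exists e0; exact: porbit_id.
have := rot_z_order zF; rewrite genus0; move: F_le F_gt0; clear; lia.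
Qed.

End IcosahedralMap.

Lemma perm_map_rem (T T' : eqType) (g : T -> T') (u : seq T) (x : T) (p : seq T') :
  x \in u -> perm_eq (map g u) (p ++ [:: g x]) -> perm_eq (map g (rem x u)) p.
Proof.
move=> xu; rewrite perm_sym perm_catC perm_sym => gu.
rewrite -(perm_cons (g x)); apply: perm_trans gu.
by have := perm_map g (perm_to_rem xu); rewrite perm_sym.
Qed.

(** * Dessins *)

Section DessinExclusion.
Variable D : dessin.

Lemma dessin_edge_connected (P : pred (edge D)) e1 : P e1 ->
  (forall e, P e -> P (black_rot D e)) -> (forall e, P e -> P (white_rot D e)) ->
  forall e, P e.
Proof.
move=> Pe1 Pb Pw.
have P_orbit (r : {perm edge D}) e f : (forall e, P e -> P (r e)) ->
    f \in porbit r e -> P e -> P f.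
  move=> Pr /porbitP[i ->] Pe; elim: i => [|i IHi]; first by rewrite expg0 perm1.
  by rewrite expgSr permM Pr.
pose Q (v : black D + white D) :=
  match v with
  | inl b => [exists e, (black_end e == b) && P e]
  | inr w => [exists e, (white_end e == w) && P e]
  end.
have Qb e : Q (inl (black_end e)) = P e.
  apply/existsP/idP => [[f /andP[Df]]|Pe]; last by exists e; rewrite eqxx.
  by apply: P_orbit Pb _; rewrite black_rotP eq_sym.
have Qw e : Q (inr (white_end e)) = P e.
  apply/existsP/idP => [[f /andP[Df]]|Pe]; last by exists e; rewrite eqxx.
  by apply: P_orbit Pw _; rewrite white_rotP eq_sym.
move=> e; rewrite -Qb.
have /connectP[p] := dessin_connected (inl (black_end e1)) (inl (black_end e)).
have : Q (inl (black_end e1)) by rewrite Qb.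
move: (inl (black_end e)) => v0.
elim: p (inl (black_end e1)) => [|v p IHp] u Qu /=; first by move=> _ ->.
case/andP=> /existsP[f Hf]; apply: IHp.
by case/orP: Hf Qu => /andP[/eqP-> /eqP->]; rewrite Qb Qw.
Qed.

Lemma sum_black_degree : \sum_(b : black D) black_degree b = #|edge D|.
Proof.
rewrite -[RHS]cardsT -sum1_card (partition_big (@black_end D) predT) //=.
apply: eq_bigr => b _; rewrite /black_degree -sum1_card.
by apply: eq_bigl => e; rewrite !inE.
Qed.

Lemma sum_white_degree : \sum_(w : white D) white_degree w = #|edge D|.
Proof.
rewrite -[RHS]cardsT -sum1_card (partition_big (@white_end D) predT) //=.
apply: eq_bigr => b _; rewrite /white_degree -sum1_card.
by apply: eq_bigl => e; rewrite !inE.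
Qed.

Lemma sum_face_degree : \sum_(F in faces D) #|F| = #|edge D|.
Proof.
rewrite -[RHS]cardsT -sum1_card.
rewrite (partition_big (porbit (face_walk D)) (mem (faces D))) /= => [|e _].
  2: exact: imset_f.
apply: eq_bigr => _ /imsetP[e _ ->]; rewrite -sum1_card; apply: eq_bigl => f.
by rewrite inE eq_porbit_mem.
Qed.

Lemma expg_porbit_const (T : finType) (x : {perm T}) r :
  (forall t, #|porbit x t| = r) -> (x ^+ r = 1)%g.
Proof.
by move=> xr; apply/permP=> t; rewrite perm1 permX -{1}(xr t) iter_porbit.
Qed.

Lemma perm_nseq_all (T : finType) (g : T -> nat) k r :
  perm_eq [seq g t | t <- enum T] (nseq k r) -> #|T| = k /\ forall t, g t = r.
Proof.
move=> gP; split=> [|t].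
  by have := perm_size gP; rewrite size_map size_nseq -cardE.
have : g t \in nseq k r by rewrite -(perm_mem gP) map_f ?mem_enum.
by case/nseqP.
Qed.

Theorem no_dessin k l m s : 0 < s -> s <> 5 -> has_genus D 0 ->
  ~ has_passport D (nseq k 3) (nseq l 2) (nseq m 5 ++ nseq 1 s).
Proof.
move=> s_gt0 s_neq5 genus0 [].
move=> /perm_nseq_all[card_b deg_b] /perm_nseq_all[card_w deg_w] deg_f.
have card_e3 : #|edge D| = k * 3.
  by rewrite -sum_black_degree (eq_bigr (fun=> 3)) // sum_nat_const card_b.
have card_e2 : #|edge D| = l * 2.
  by rewrite -sum_white_degree (eq_bigr (fun=> 2)) // sum_nat_const card_w.
have card_e5 : #|edge D| = m * 5 + s.
  rewrite -sum_face_degree -big_enum /=.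
  rewrite -(big_map (fun F : {set edge D} => #|F|) xpredT id).
  by rewrite (perm_big _ deg_f) big_cat /= big_nseq big_seq1 iter_addn_0 mulnC.
have card_f : #|faces D| = m.+1.
  by have := perm_size deg_f; rewrite size_map -cardE size_cat !size_nseq addn1.
have x3 : (black_rot D ^+ 3 = 1)%g.
  apply: expg_porbit_const => e; rewrite -(deg_b (black_end e)).
  by apply: eq_card => f; rewrite black_rotP inE.
have y2 : (white_rot D ^+ 2 = 1)%g.
  apply: expg_porbit_const => e; rewrite -(deg_w (white_end e)).
  by apply: eq_card => f; rewrite white_rotP inE.
have /mapP[F] : s \in [seq #|F| | F : {set edge D} <- enum (faces D)].
  by rewrite (perm_mem deg_f) mem_cat mem_seq1 eqxx orbT.
rewrite mem_enum => F_face card_F; have [e0 _ DF] := imsetP F_face.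
apply: s_neq5; rewrite card_F DF.
apply: (icosahedral_rigidity dessin_edge_connected x3 y2).
  move=> e; rewrite -DF inE => eF.
  suff <- : #|porbit (face_walk D) e| = 5 by rewrite permX iter_porbit.
  have F_enum : F \in enum (faces D) by rewrite mem_enum.
  have deg_rem : perm_eq
      [seq #|G| | G : {set edge D} <- rem F (enum (faces D))] (nseq m 5).
    by apply: (perm_map_rem (g := fun G : {set edge D} => #|G|)); rewrite -?card_F.
  have : #|porbit (face_walk D) e| \in nseq m 5.
    rewrite -(perm_mem deg_rem) map_f // mem_rem_uniq ?enum_uniq // inE mem_enum.
    rewrite imset_f // andbT; apply: contra eF => /eqP <-; exact: porbit_id.
  by case/nseqP.
move: genus0; rewrite /has_genus /euler_char card_b card_w card_f -DF -card_F.
move: card_e3 card_e2 card_e5; move: #|edge D| => n; clear; lia.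
Qed.
End DessinExclusion.

(** * Polynomial solutions of A^3 - B^2 = kappa C^5 *)

Section IcosahedralForms.
Local Open Scope ring_scope.
Variable K : numFieldType.
Implicit Types A B C D p q : {poly K}.

Lemma deriv_expS p n : (p ^+ n.+1)^`() = n.+1%:R * p ^+ n * p^`().
Proof. by rewrite deriv_exp -mulr_natl [p^`() * _]mulrC mulrA. Qed.

Lemma deriv_natl p n : (n%:R * p)^`() = n%:R * p^`().
Proof. by rewrite !mulr_natl derivMn. Qed.

Lemma size_deriv_le p : (size p^`() <= (size p).-1)%N.
Proof. exact: size_poly. Qed.

(** Differentiating the relation and eliminating [kappa] gives
    A^2 (3 A' C - 5 A C') = B (2 B' C - 5 B C').  Up to a constant, the derivative
    of A^3 / C^5 is A^2 B D / C^6, so that the critical points of this function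
    outside the roots of [A], [B] and [C] are roots of the cofactor [D]. *)
Lemma jacobian_factor A B C (kappa : K) :
  A ^+ 3 - B ^+ 2 = kappa *: C ^+ 5 -> A != 0 -> B != 0 -> coprimep A B ->
  exists D, 3 * A^`() * C - 5 * A * C^`() = B * D
         /\ 2 * B^`() * C - 5 * B * C^`() = A ^+ 2 * D.
Proof.
move=> eqABC A0 B0 copAB.
have deriv_eq : 3 * A ^+ 2 * A^`() - 2 * B * B^`() = kappa *: (5 * C ^+ 4 * C^`()).
  have := congr1 deriv eqABC.
  by rewrite derivB derivZ !deriv_expS expr1.
have cross : A ^+ 2 * (3 * A^`() * C - 5 * A * C^`())
           = B * (2 * B^`() * C - 5 * B * C^`()).
  apply/eqP; rewrite -subr_eq0; apply/eqP.
  transitivity ((3 * A ^+ 2 * A^`() - 2 * B * B^`()) * C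
                - 5 * C^`() * (A ^+ 3 - B ^+ 2)); first by ring.
  rewrite deriv_eq eqABC -!mul_polyC; ring.
have : B %| 3 * A^`() * C - 5 * A * C^`().
  rewrite -(@Gauss_dvdpr _ _ (A ^+ 2)); first by rewrite cross dvdp_mulr.
  by rewrite coprimep_sym coprimep_expl.
case/dvdpP => D DE; exists D; rewrite DE mulrC; split=> //.
apply: (mulfI B0); rewrite -cross DE; ring.
Qed.

(** Eliminating [B] from the two equations gives a second order equation for [A]
    and [C], which shows that [C] divides 25 C'^2 - d^2 A.  The derivative of this
    divisibility and the second order equation itself determine the quotient [E]
    modulo [C]: 11 E = 300 C''.  The degree of [E] is too small for the congruence
    not to be an equality.  The hypothesis on the degrees is what the
    Riemann-Hurwitz formula gives in genus 0. *)
Lemma hessian_relation A B C (d : K) : d != 0 -> coprimep C A -> A != 0 -> C != 0 ->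
    size A = (size C).-1.*2.-1 -> 
    3 * A^`() * C - 5 * A * C^`() = d *: B ->
    2 * B^`() * C - 5 * B * C^`() = d *: A ^+ 2 ->
  11 * (25 * C^`() ^+ 2 - d%:P ^+ 2 * A) = 300 * C * C^`()^`().
Proof.
move=> d0 copCA A0 C0 sizeA eqB eqA.
set dA := A^`() in eqB *; set dC := C^`() in eqA eqB *.
set ddA := dA^`(); set ddC := dC^`().
have eqA' : A * (25 * dC ^+ 2 - d%:P ^+ 2 * A)
          = C * (10 * A * ddC + 19 * dA * dC - 6 * ddA * C).
  have dB : d%:P * B^`() = 3 * ddA * C - 2 * dA * dC - 5 * A * ddC.
    have := congr1 deriv eqB; rewrite derivZ -mul_polyC => <-.
    by rewrite derivB -!mulrA !deriv_natl !derivM -/dA -/dC -/ddA -/ddC; ring.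
  have : d%:P * (2 * B^`() * C - 5 * B * dC) = d%:P ^+ 2 * A ^+ 2.
    by rewrite eqA -mul_polyC; ring.
  have -> : d%:P * (2 * B^`() * C - 5 * B * dC)
          = 2 * (d%:P * B^`()) * C - 5 * (d%:P * B) * dC by ring.
  rewrite dB mul_polyC -eqB => H.
  transitivity (25 * A * dC ^+ 2 - d%:P ^+ 2 * A ^+ 2); first by ring.
  by rewrite -H; ring.
have /dvdpP[E defE] : C %| 25 * dC ^+ 2 - d%:P ^+ 2 * A.
  by rewrite -(Gauss_dvdpr _ copCA) eqA' dvdp_mulr.
have eqE : A * E = 10 * A * ddC + 19 * dA * dC - 6 * ddA * C.
  by apply: (mulfI C0); rewrite -eqA' defE; ring.
have dvdC : C %| A * (11 * E - 300 * ddC).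
  have eqdE : dC * E + C * E^`() = 50 * dC * ddC - d%:P ^+ 2 * dA.
    have := congr1 deriv defE; rewrite derivB deriv_natl deriv_expS expr1.
    rewrite -rmorphXn mul_polyC derivZ -mul_polyC rmorphXn derivM -/dA -/dC -/ddC.
    move=> H; transitivity (E^`() * C + E * dC); [ring | rewrite -H; ring].
  have dd0 : 4 * d ^+ 2 != 0 by rewrite mulf_neq0 ?expf_neq0 ?pnatr_eq0.
  rewrite -(dvdpZr _ _ dd0) -mul_polyC rmorphM rmorphXn rmorph_nat.
  apply/dvdpP.
  exists (19 * (50 * E * ddC - E ^+ 2 - 25 * dC * E^`()) - 150 * d%:P ^+ 2 * ddA).
  apply/eqP; rewrite -subr_eq0; apply/eqP.
  transitivity (25 * d%:P ^+ 2 *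
      (A * E - (10 * A * ddC + 19 * dA * dC - 6 * ddA * C))
    + 19 * 25 * dC * (dC * E + C * E^`() - (50 * dC * ddC - d%:P ^+ 2 * dA))
    + 19 * (E - 50 * ddC) * (E * C - (25 * dC ^+ 2 - d%:P ^+ 2 * A))).
    ring.
  by rewrite eqE eqdE defE !subrr !mulr0 !addr0.
have dvdE : C %| 11 * E - 300 * ddC by rewrite -(Gauss_dvdpr _ copCA).
suff E0 : 11 * E - 300 * ddC = 0.
  rewrite defE.
  transitivity (C * (11 * E - 300 * ddC) + 300 * C * ddC); first by ring.
  by rewrite E0 mulr0 add0r.
have C_gt0 : (0 < size C)%N by rewrite size_poly_gt0.
have sdC : (size dC <= (size C).-1)%N by exact: size_deriv_le.
have sddC : (size ddC <= (size dC).-1)%N by exact: size_deriv_le.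
have natP n : n%:R = (n%:R)%:P :> {poly K} by rewrite rmorph_nat.
have snat n p : (size (n%:R * p)%R <= size p)%N.
  by rewrite natP mul_polyC size_scale_leq.
have sE : (size E <= (size C).-2)%N.
  have [->|E0] := eqVneq E 0; first by rewrite size_poly0.
  have := size_mul E0 C0; rewrite -defE => sEC.
  have : (size (25 * dC ^+ 2 - d%:P ^+ 2 * A)%R <= ((size C).-1.*2).-1)%N.
    rewrite (leq_trans (size_polyD _ _)) // geq_max size_polyN; apply/andP; split.
      rewrite (leq_trans (snat _ _)) // expr2 (leq_trans (size_polyMleq _ _)) //.
      by move: sdC; lia.
    by rewrite -rmorphXn mul_polyC (leq_trans (size_scale_leq _ _)) // sizeA.
  rewrite sEC; move: C_gt0; move: (size C) (size E); clear; lia.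
apply/eqP; apply: contraLR dvdE => nz; apply/negP => /(dvdp_leq nz).
apply/negP; rewrite -ltnNge (leq_ltn_trans (size_polyD _ _)) // size_polyN.
have [E_lt ddC_lt] : (size E < size C)%N /\ (size ddC < size C)%N.
  move: C_gt0 sE sddC sdC; move: (size C) (size E) (size dC) (size ddC).
  by clear; lia.
by rewrite gtn_max (leq_ltn_trans (snat _ _)) // (leq_ltn_trans (snat _ _)).
Qed.

Lemma coef_top_mul p q a b : (size p <= a.+1)%N -> (size q <= b.+1)%N ->
  (p * q)`_(a + b) = p`_a * q`_b.
Proof.
move=> sp sq; have lt_a : (a < (a + b).+1)%N by rewrite ltnS leq_addr.
rewrite coefM (bigD1 (Ordinal lt_a)) //= addKn big1 ?addr0 // => i neq_ia.
have {neq_ia} : i != a :> nat by [].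
rewrite neq_ltn => /orP[lt_ia|lt_ai]; last first.
  by rewrite nth_default ?mul0r ?(leq_trans sp).
by rewrite [X in _ * X]nth_default ?mulr0 // (leq_trans sq) // ltn_subRL ltn_add2r.
Qed.

(** The coefficients of highest degree of the equation for [B] give d = s, and
    those of the Hessian relation then give
    11 (25 (s + 6)^2 - s^2) = 300 (s + 6) (s + 5), that is
    (s + 5) (s - 5) = 0. *)
Lemma pole_order_eq5 A B C (d : K) s : (0 < s)%N ->
    A \is monic -> B \is monic -> C \is monic -> coprimep C A ->
    size A = (2 * s + 11)%N -> size B = (3 * s + 16)%N -> size C = (s + 7)%N ->
    3 * A^`() * C - 5 * A * C^`() = d *: B ->
    2 * B^`() * C - 5 * B * C^`() = d *: A ^+ 2 -> d != 0 ->
  s = 5%N.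
Proof.
move=> s_gt0 /monicP lA /monicP lB /monicP lC copCA sA sB sC eqB eqA d0.
have A0 : A != 0 by rewrite -size_poly_gt0 sA; lia.
have C0 : C != 0 by rewrite -size_poly_gt0 sC; lia.
have {}lA : A`_(2 * s + 10) = 1 by rewrite -[RHS]lA lead_coefE sA; congr _`__; lia.
have {}lB : B`_(3 * s + 15) = 1 by rewrite -[RHS]lB lead_coefE sB; congr _`__; lia.
have {}lC : C`_(s + 6) = 1 by rewrite -[RHS]lC lead_coefE sC; congr _`__; lia.
have sdA := size_deriv_le A; rewrite sA in sdA.
have sdC := size_deriv_le C; rewrite sC in sdC.
have sddC : (size C^`()^`() <= s + 5)%N.
  by move: (size_deriv_le C^`()) sdC; move: (size _) (size _); clear; lia.
have ldA : A^`()`_(2 * s + 9) = (2 * s + 10)%:R.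
  by rewrite coef_deriv -addnS lA.
have ldC : C^`()`_(s + 5) = (s + 6)%:R by rewrite coef_deriv -addnS lC.
have lddC : C^`()^`()`_(s + 4) = (s + 6)%:R * (s + 5)%:R.
  by rewrite coef_deriv -addnS ldC -[LHS]mulr_natr.
have ds : d = s%:R.
  have /(congr1 (fun p => p`_(3 * s + 15))) := eqB.
  rewrite coefZ lB mulr1 => <-; rewrite coefB -!mulrA !mulr_natl !coefMn.
  have -> : (A^`() * C)`_(3 * s + 15) = (2 * s + 10)%:R.
    have -> : (3 * s + 15 = (2 * s + 9) + (s + 6))%N by lia.
    by rewrite coef_top_mul ?ldA ?lC ?mulr1 // ?sC; lia.
  have -> : (A * C^`())`_(3 * s + 15) = (s + 6)%:R.
    have -> : (3 * s + 15 = (2 * s + 10) + (s + 5))%N by lia.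
    by rewrite coef_top_mul ?ldC ?lA ?mul1r // ?sA; lia.
  rewrite -!mulrnA -mulrnBr; last by lia.
  by congr (_ *+ _); lia.
have := hessian_relation d0 copCA A0 C0 _ eqB eqA.
rewrite sA sC => /(_ ltac:(lia)) /(congr1 (fun p => p`_(2 * s + 10))).
rewrite -rmorphXn mul_polyC -[300 * _ * _]mulrA !mulr_natl !coefMn coefB coefMn.
rewrite coefZ lA mulr1.
have -> : (C^`() ^+ 2)`_(2 * s + 10) = (s + 6)%:R ^+ 2.
  have -> : (2 * s + 10 = (s + 5) + (s + 5))%N by lia.
  by rewrite expr2 coef_top_mul ?ldC //; lia.
have -> : (C * C^`()^`())`_(2 * s + 10) = (s + 6)%:R * (s + 5)%:R.
  have -> : (2 * s + 10 = (s + 6) + (s + 4))%N by lia.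
  by rewrite coef_top_mul ?lC ?lddC ?mul1r // ?sC; lia.
rewrite ds => H.
have : (11 * 25 * (s + 6) ^ 2)%:R = (11 * s ^ 2 + 300 * (s + 6) * (s + 5))%:R :> K.
  rewrite natrD !natrM; apply/eqP; rewrite -subr_eq0.
  apply/eqP; move/eqP: H; rewrite -subr_eq0 => /eqP H; rewrite -[RHS]H.
  ring.
by move/eqP; rewrite eqr_nat => /eqP; nia.
Qed.
(** The shape in which the degree and the leading coefficient of the Jacobian
    can be read off. *)
Lemma jacobian_split A C :
  3 * A^`() * C - 5 * A * C^`() = (A^`() * C) *+ 8 - (A * C)^`() *+ 5.
Proof. by rewrite derivM; ring. Qed.

End IcosahedralForms.

(** * Belyi functions with their exceptional pole at infinity *)

Section PolynomialRoots.
Local Open Scope ring_scope.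
Variable K : closedFieldType.
Implicit Types p : {poly K}.

Lemma mup_gt1 p z : p != 0 -> root p z -> root p^`() z -> (1 < mup z p)%N.
Proof.
move=> p0 /factor_theorem[q Dp]; rewrite Dp derivM derivXsubC mulr1 => rp'.
have /factor_theorem[r Dq] : root q z.
  by move: rp'; rewrite /root !hornerE subrr mulr0 add0r.
by rewrite -Dp mup_geq // Dp Dq -mulrA -expr2 dvdp_mulIr.
Qed.

Lemma poly_constant_multiplicity p (r : seq K) e :
    p != 0 -> uniq r -> (forall z, root p z = (z \in r)) ->
    {in r, forall z, mup z p = e} ->
  p = lead_coef p *: (\prod_(z <- r) ('X - z%:P)) ^+ e.
Proof.
move=> p0 Ur rootp mulp; have [rs Dp] := closed_field_poly_normal p.
have lp0 : lead_coef p != 0 by rewrite lead_coef_eq0.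
have count_rs z : z \in r -> count_mem z rs = e.
  move=> zr; rewrite -(mulp z zr) [in RHS]Dp -mul_polyC mupMr ?mu_prod_XsubC //.
  by rewrite rootC.
have mem_rs z : (z \in undup rs) = (z \in r).
  by rewrite mem_undup -rootp Dp rootZ // root_prod_XsubC.
rewrite [in LHS]Dp; congr (_ *: _).
rewrite -big_undup_iterop_count -prodrXl.
rewrite (perm_big r) /=; last by apply: uniq_perm => //; apply: undup_uniq.
by apply: eq_big_seq => z zr; rewrite count_rs // -Monoid.iteropE.
Qed.

End PolynomialRoots.

Section RatfunFibers.
Local Open Scope ring_scope.
Variables (K : fieldType) (f : ratfun K).

Lemma mkP1_None (a b : K) : mkP1 a b = None <-> b = 0.
Proof. by rewrite /mkP1; case: eqP. Qed.

Lemma num_den_noroot z : root (num f) z -> root (den f) z -> False.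
Proof.
move=> rn rd; have := coprimep_root (num_den_coprime f) rn.
by rewrite (rootP rd) eqxx.
Qed.

Lemma ratfun_eval_root z v :
  (ratfun_eval f (Some z) = v) <-> root (fiber_poly f v) z.
Proof.
case: v => [c|] /=; last by rewrite mkP1_None; split=> /rootP.
rewrite /root hornerD hornerN hornerZ /mkP1; have [d0|d0] := eqVneq (den f).[z] 0.
  split=> //; rewrite d0 mulr0 subr0 => n0; case: (@num_den_noroot z) => //.
  exact/rootP.
rewrite subr_eq0; split=> [[<-]|/eqP->]; first by rewrite divfK.
by rewrite mulfK.
Qed.

Lemma pmap_Some (T : eqType) (t : seq (option T)) : None \notin t ->
  map Some (pmap id t) = t.
Proof.
by elim: t => //= -[x|//] t IHt /=; rewrite inE /= => /IHt->.
Qed.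

End RatfunFibers.

Section PoleAtInfinity.
Local Open Scope ring_scope.
Variables (K : numClosedFieldType) (f : ratfun K).

Lemma fiber_poly_normal v (t : seq (P1 K)) q e :
    fiber_poly f v != 0 -> uniq t -> None \notin t ->
    (forall z, Some z \in t <-> ratfun_eval f (Some z) = v) ->
    perm_eq [seq ratfun_mult f x | x <- t] (nseq q e) ->
  exists P : {poly K},
    [/\ P \is monic, size P = q.+1,
        forall z, root P z <-> ratfun_eval f (Some z) = v,
        forall z, root P z -> ~~ root P^`() z
      & fiber_poly f v = lead_coef (fiber_poly f v) *: P ^+ e].
Proof.
move=> p0 Ut tN memt multt; have Dt := pmap_Some tN; set r := pmap id t in Dt.
have Ur : uniq r by rewrite -(map_inj_uniq Some_inj) Dt.
have memr z : z \in r <-> ratfun_eval f (Some z) = v.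
  by rewrite -memt -Dt mem_map //; exact: Some_inj.
have rootP z : root (\prod_(z <- r) ('X - z%:P)) z = (z \in r).
  by rewrite root_prod_XsubC.
exists (\prod_(z <- r) ('X - z%:P)); split=> [||z|z|].
- exact: monic_prod_XsubC.
- rewrite size_prod_XsubC; have := perm_size multt.
  by rewrite size_nseq -Dt !size_map => ->.
- by rewrite rootP memr.
- move=> rz; have := Ur; rewrite -separable_prod_XsubC separable_poly.unlock.
  by move/coprimep_root => /(_ _ rz).
apply: poly_constant_multiplicity => // [z|z zr].
  apply/idP/idP => [/ratfun_eval_root/memr//|/memr/ratfun_eval_root//].
have : ratfun_mult f (Some z) \in nseq q e.
  by rewrite -(perm_mem multt) map_f // -Dt mem_map //; exact: Some_inj.
by case/nseqP=> <- _; rewrite /ratfun_mult; have /memr-> := zr.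
Qed.

(** The absence of further critical values forces the cofactor [D] of
    [jacobian_factor] to be constant.  Comparing degrees then gives
    k + m = l + 1, the Riemann-Hurwitz formula, and with 3 k = 2 l = 5 m + s all
    degrees are expressed by [s]. *)
Lemma belyi_pole_at_infinity k l m s (t : seq (P1 K)) : (0 < s)%N ->
    belyi f -> fiber_partition f (Some 0) (nseq k 3) ->
    fiber_partition f (Some 1) (nseq l 2) ->
    ratfun_eval f None = None -> ratfun_mult f None = s ->
    uniq t -> None \notin t ->
    (forall z, Some z \in t <-> ratfun_eval f (Some z) = None) ->
    perm_eq [seq ratfun_mult f x | x <- t] (nseq m 5) ->
  s = 5%N.
Proof.
move=> s_gt0 [n_gt0 crit] [t0 [Ut0 memt0 mult0]] [t1 [Ut1 memt1 mult1]].
move=> fN; set n := ratfun_degree f in n_gt0 * => fN_mult.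
have multN : (n - (size (den f)).-1)%N = s by rewrite -fN_mult /ratfun_mult fN.
move=> Ut tN memt multt.
have denn : (den f)`_n = 0 by move: fN => /= /mkP1_None.
have size_den : ((size (den f)).-1 + s = n)%N 
  by rewrite -multN subnKC // ltnW // -subn_gt0 multN.
have size_num : size (num f) = n.+1.
  have arith a b c : maxn a.-1 b.-1 = c -> (b.-1 + s = c)%N -> (0 < c)%N ->
    a = c.+1 by clear -s_gt0; lia.
  exact: arith size_den n_gt0.
have num0 : num f != 0 by rewrite -size_poly_gt0 size_num.
have den_lt : (size (den f) < size (num f))%N.
  by rewrite size_num; move: size_den s_gt0; clear; lia.
have size_fib c : size (num f - c *: den f) = n.+1 /\
    lead_coef (num f - c *: den f) = lead_coef (num f).
  have lt_c : (size (- (c *: den f)) < size (num f))%N.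
    by rewrite size_polyN (leq_ltn_trans (size_scale_leq _ _)).
  by rewrite size_polyDl // lead_coefDl.
have fib0 c : num f - c *: den f != 0.
  by rewrite -size_poly_gt0; case: (size_fib c) => ->.
have notN (u : seq (P1 K)) c :
    (forall x, x \in u <-> ratfun_eval f x = Some c) -> None \notin u.
  by move=> memu; apply/negP => /memu; rewrite fN.
have [A [Am sA rA sepA DA]] :=
  fiber_poly_normal (v := Some 0) (fib0 0) Ut0 (notN _ _ memt0)
    (fun z => memt0 _) mult0.
have [B [Bm sB rB sepB DB]] :=
  fiber_poly_normal (v := Some 1) (fib0 1) Ut1 (notN _ _ memt1)
    (fun z => memt1 _) mult1.
have [C [Cm sC rC sepC DC]] :=
  fiber_poly_normal (v := None) (den_neq0 f) Ut tN memt multt.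
move: DA DB DC; rewrite /= !(proj2 (size_fib _)) scale0r subr0 scale1r.
set al := lead_coef _; set ga := lead_coef _ => DA DB DC.
have al0 : al != 0 by rewrite lead_coef_eq0.
have ga0 : ga != 0 by rewrite lead_coef_eq0 den_neq0.
have A0 := monic_neq0 Am; have B0 := monic_neq0 Bm; have C0 := monic_neq0 Cm.
have n3 : n = (3 * k)%N.
  have /(congr1 predn) := size_num.
  rewrite DA size_scale // size_exp sA /= => <-; exact: mulnC.
have n2 : n = (2 * l)%N.
  have /(congr1 predn) := proj1 (size_fib 1).
  rewrite scale1r DB size_scale // size_exp sB /= => <-; exact: mulnC.
have n5 : n = (5 * m + s)%N.
  by rewrite -size_den DC size_scale // size_exp sC /= mulnC.
have copAB : coprimep A B.
  apply: Pdiv.ClosedField.root_coprimep => z /rA eA; apply/negP => /rB.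
  by rewrite eA => -[/eqP]; rewrite eq_sym oner_eq0.
have copCA : coprimep C A.
  by apply: Pdiv.ClosedField.root_coprimep => z /rC eC;
     apply/negP => /rA; rewrite eC.
have eqABC : A ^+ 3 - B ^+ 2 = (ga / al) *: C ^+ 5.
  apply: (scalerI al0); rewrite scalerBr scalerA mulrCA divff // mulr1.
  by rewrite -DA -DB -DC opprB addrC subrK.
have [D [eqB eqA]] := jacobian_factor eqABC A0 B0 copAB.
(* At a root of [A], [B] or [C], which is simple, one of the two multiples of [D]
   given by [eqB] and [eqA] does not vanish; elsewhere a root of [D] is a critical
   point. *)
have D_noroot z : ~~ root D z.
  apply/negP => Dz.
  have Pz : (3 * A^`() * C - 5 * A * C^`()).[z] = 0.
    by rewrite eqB hornerM (rootP Dz) mulr0.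
  have Qz : (2 * B^`() * C - 5 * B * C^`()).[z] = 0.
    by rewrite eqA hornerM (rootP Dz) mulr0.
  have nat_neq0 i (x : K) : x != 0 -> i.+1%:R * x != 0.
    by move=> ?; rewrite mulf_neq0 ?pnatr_eq0.
  have hornerS i (p q : {poly K}) :
      (i.+1%:R * p * q).[z] = i.+1%:R * (p.[z] * q.[z]).
    by rewrite -mulrA mulr_natl hornerMn hornerM mulr_natl.
  have rootN (p : {poly K}) : p.[z] != 0 = ~~ root p z by [].
  move: Pz Qz; rewrite !hornerD !hornerN !hornerS => Pz Qz.
  have [Az|Az] := boolP (root A z).
    have := sepA _ Az; rewrite -rootN => dAz.
    have Cz : C.[z] != 0 by rewrite rootN; apply/negP => /rC; have /rA-> := Az.
    have := nat_neq0 2 _ (mulf_neq0 dAz Cz).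
    by move/eqP: Pz; rewrite (rootP Az) mul0r mulr0 subr0 => ->.
  have [Bz|Bz] := boolP (root B z).
    have := sepB _ Bz; rewrite -rootN => dBz.
    have Cz : C.[z] != 0 by rewrite rootN; apply/negP => /rC; have /rB-> := Bz.
    have := nat_neq0 1 _ (mulf_neq0 dBz Cz).
    by move/eqP: Qz; rewrite (rootP Bz) mul0r mulr0 subr0 => ->.
  have [Cz|Cz] := boolP (root C z).
    have := sepC _ Cz; rewrite -rootN => dCz.
    have := nat_neq0 4 _ (mulf_neq0 (Az : A.[z] != 0) dCz).
    by move/eqP: Pz; rewrite (rootP Cz) mulr0 mulr0 sub0r oppr_eq0 => ->.
  have denz : (den f).[z] != 0 by rewrite DC hornerZ horner_exp mulf_neq0 ?expf_neq0.
  pose c := (num f).[z] / (den f).[z].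
  have fz : ratfun_eval f (Some z) = Some c by rewrite /= /mkP1 (negPf denz).
  have root_c : root (num f - c *: den f) z by have /ratfun_eval_root := fz.
  have droot_c : root (num f - c *: den f)^`() z.
    rewrite /root -(mulrI_eq0 _ (mulfI denz)) derivB derivZ hornerD hornerN hornerZ.
    rewrite mulrBr mulrA [_ * c]mulrC divfK // DA DC !derivZ !deriv_expS !hornerZ.
    rewrite !(horner_exp, hornerM) -!polyC_natr !hornerC; apply/eqP.
    transitivity (al * ga * A.[z] ^+ 2 * C.[z] ^+ 4 *
      (3 * (A^`().[z] * C.[z]) - 5 * (A.[z] * C^`().[z]))).
      ring.
    by rewrite Pz mulr0.
  have mult_c : (1 < ratfun_mult f (Some z))%N.
    rewrite /ratfun_mult fz. exact: mup_gt1 (fib0 c) root_c droot_c.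
  case: (crit (Some c)) => [|[c0]|[c1]|//]; first by exists (Some z).
    by move/negP: Az; apply; apply/rA; rewrite fz c0.
  by move/negP: Bz; apply; apply/rB; rewrite fz c1.
have topP : (3 * A^`() * C - 5 * A * C^`())`_(k + m).-1 = s%:R.
  rewrite jacobian_split.
  have k_gt0 : (0 < k)%N by move: n_gt0; rewrite n3; clear; lia.
  have -> : (k + m).-1 = (k.-1 + m)%N by move: k_gt0; clear; lia.
  have lA : A`_k = 1 by have /monicP := Am; rewrite lead_coefE sA.
  have lC : C`_m = 1 by have /monicP := Cm; rewrite lead_coefE sC.
  rewrite coefB !coefMn coef_deriv -addSn prednK //.
  rewrite !coef_top_mul ?sA ?sC //; last first.
    by rewrite (leq_trans (size_deriv_le _)) // sA prednK.
  rewrite coef_deriv prednK // lA lC !mulr1 -!mulrnA -mulrnBr; last first.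
    by move: n3 n5; clear; lia.
  by congr (_ *+ _); move: n3 n5; clear; lia.
have s0 : s%:R != 0 :> K by rewrite pnatr_eq0 -lt0n.
have sizeD : size D = 1%N.
  by apply/eqP; apply: contraT => /closed_rootP[z]; rewrite (negPf (D_noroot z)).
have [d d0 Dd] : exists2 d, d != 0 & D = d%:P.
  by have /size_poly1P[d ? ->] : size D == 1%N; [exact/eqP | exists d].
rewrite Dd [B * _]mulrC mul_polyC in eqB.
rewrite Dd [A ^+ 2 * _]mulrC mul_polyC in eqA.
have l_km : l.+1 = (k + m)%N.
  apply/eqP; rewrite eqn_leq; apply/andP; split.
    rewrite -sB -(size_scale B d0) -eqB.
    rewrite jacobian_split (leq_trans (size_polyD _ _)) // geq_max size_polyN.
    rewrite -!scaler_nat.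
    apply/andP; split; apply: leq_trans (size_scale_leq _ _) _.
      apply: leq_trans (size_polyMleq _ _) _.
      by move: (size_deriv_le A); rewrite sA sC; move: (size _); clear; lia.
    apply: leq_trans (size_deriv_le _) _.
    by have := size_polyMleq A C; rewrite sA sC; move: (size _); clear; lia.
  rewrite -sB -(size_scale B d0) -eqB leqNgt; apply: contra s0 => lt_km.
  by rewrite -topP nth_default //; move: lt_km; move: (size _); clear; lia.
apply: (pole_order_eq5 s_gt0 Am Bm Cm copCA _ _ _ eqB eqA d0).
- by rewrite sA; move: l_km n3 n2 n5; clear; lia.
- by rewrite sB; move: l_km n3 n2 n5; clear; lia.
- by rewrite sC; move: l_km n3 n2 n5; clear; lia.
Qed.

End PoleAtInfinity.

(** * Moving a point to infinity *)

Section Reparametrization.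
Local Open Scope ring_scope.
Variable K : closedFieldType.
Implicit Types (f g : ratfun K) (p q : {poly K}).

Definition reparametrizes f g (M N : P1 K -> P1 K) :=
  [/\ cancel M N, cancel N M, ratfun_degree g = ratfun_degree f,
      forall x, ratfun_eval g x = ratfun_eval f (M x)
    & forall x, ratfun_mult g x = ratfun_mult f (M x)].

Lemma reparametrizes_trans f g h M N M' N' :
  reparametrizes f g M N -> reparametrizes g h M' N' ->
  reparametrizes f h (M \o M') (N' \o N).
Proof.
move=> [MN NM dg eg mg] [MN' NM' dh eh mh]; split=> [x|x||x|x] /=.
- by rewrite MN MN'.
- by rewrite NM' NM.
- by rewrite dh.
- by rewrite eh eg.
- by rewrite mh mg.
Qed.

Lemma reparametrizes_belyi f g M N :
  reparametrizes f g M N -> belyi f -> belyi g.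
Proof.
move=> [MN NM dg eg mg] [n_gt0 crit]; split=> [|v [x gx mx]]; first by rewrite dg.
by apply: crit; exists (M x); rewrite -?eg -?mg.
Qed.

Lemma reparametrizes_fiber f g M N v parts :
  reparametrizes f g M N -> fiber_partition f v parts -> fiber_partition g v parts.
Proof.
move=> [MN NM dg eg mg] [t [Ut memt multt]]; exists (map N t); split.
- by rewrite map_inj_uniq //; exact: can_inj NM.
- by move=> x; rewrite -[x in x \in _]MN mem_map ?memt -?eg //; exact: can_inj NM.
rewrite -map_comp (eq_map (g := ratfun_mult f)) // => x /=.
by rewrite mg NM.
Qed.

Lemma fiber_poly_neq0 f v : (0 < ratfun_degree f)%N -> fiber_poly f v != 0.
Proof.
case: v => [c|] n_gt0 /=; last exact: den_neq0.
apply: contraTneq n_gt0 => /eqP; rewrite subr_eq0 => /eqP Dnum.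
have : den f %= 1.
  have /coprimepP := num_den_coprime f; apply => //.
  by rewrite Dnum -mul_polyC dvdp_mull.
rewrite -size_poly_eq1 => /eqP sd; rewrite /ratfun_degree sd Dnum.
by have := size_scale_leq c (den f); rewrite sd; move: (size _) => a; lia.
Qed.

Lemma size_fiber_poly f v : (size (fiber_poly f v) <= (ratfun_degree f).+1)%N.
Proof.
have [sn sd] : (size (num f) <= (ratfun_degree f).+1)%N
    /\ (size (den f) <= (ratfun_degree f).+1)%N.
  by rewrite /ratfun_degree; move: (size _) (size _) => a b; lia.
case: v => [c|] //=; rewrite (leq_trans (size_polyD _ _)) // geq_max sn size_polyN.
exact: leq_trans (size_scale_leq _ _) sd.
Qed.

Lemma ratfun_degree_coef f : (0 < ratfun_degree f)%N ->
  ((num f)`_(ratfun_degree f) != 0) || ((den f)`_(ratfun_degree f) != 0).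
Proof.
rewrite /ratfun_degree /maxn; case: ifP => [_|lt_n] n_gt0.
  by rewrite -lead_coefE lead_coef_eq0 den_neq0 orbT.
rewrite -lead_coefE lead_coef_eq0 -size_poly_gt0.
by rewrite (leq_trans n_gt0) // leq_pred.
Qed.

Lemma ratfun_degree_eq f n : (size (num f) <= n.+1)%N -> (size (den f) <= n.+1)%N ->
  ((num f)`_n != 0) || ((den f)`_n != 0) -> ratfun_degree f = n.
Proof.
move=> sn sd nz; apply/eqP; rewrite eqn_leq /ratfun_degree geq_max leq_max.
have le_pred (p : {poly K}) : (size p <= n.+1)%N -> ((size p).-1 <= n)%N.
  by move: (size p) => a; lia.
have ge_pred (p : {poly K}) : p`_n != 0 -> (n <= (size p).-1)%N.
  move=> pn; have : (n < size p)%N.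
    by rewrite ltnNge; apply: contra pn => /leq_sizeP->.
  by move: (size p) => a; lia.
by rewrite !le_pred //=; case/orP: nz => /ge_pred->; rewrite ?orbT.
Qed.

Section Translation.
Variable c : K.
Let T p := p \Po ('X + c%:P).

Let size_T p : size (T p) = size p.
Proof. by rewrite size_comp_poly2 // size_XaddC. Qed.

Let horner_T p z : (T p).[z] = p.[z + c].
Proof. by rewrite horner_comp !hornerE. Qed.

Let coef_T p n : (size p <= n.+1)%N -> (T p)`_n = p`_n.
Proof.
rewrite leq_eqVlt => /predU1P[sp|sp]; last by rewrite !nth_default ?size_T.
have lead q : size q = n.+1 -> q`_n = lead_coef q by rewrite lead_coefE => ->.
rewrite !lead ?size_T // lead_coef_comp ?size_XaddC //.
by rewrite lead_coefXaddC expr1n mulr1.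
Qed.

Let mup_T p z : p != 0 -> mup z (T p) = mup (z + c) p.
Proof.
move=> p0; have [e [q]] := multiplicity_XsubC p (z + c); rewrite p0 /= => qz Dp.
have DT : T p = T q * ('X - z%:P) ^+ e.
  rewrite /T Dp rmorphM rmorphXn rmorphB /= comp_polyX comp_polyC polyCD.
  by congr (_ * _ ^+ _); ring.
rewrite DT Dp !mupMr ?mup_XsubCX ?eqxx //.
by rewrite /root horner_T.
Qed.

Lemma translate_ratfun f : (0 < ratfun_degree f)%N ->
  exists g, reparametrizes f g (omap (+%R^~ c)) (omap (+%R^~ (- c))).
Proof.
move=> n_gt0.
have den0 : T (den f) != 0 by rewrite -size_poly_gt0 size_T size_poly_gt0 den_neq0.
have cop : coprimep (T (num f)) (T (den f)).
  apply: Pdiv.ClosedField.root_coprimep => z; rewrite /root !horner_T.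
  exact: coprimep_root (num_den_coprime f).
exists (RatFun den0 cop).
set g := RatFun _ _.
have deg_g : ratfun_degree g = ratfun_degree f by rewrite /ratfun_degree /= !size_T.
have eval_g x : ratfun_eval g x = ratfun_eval f (omap (+%R^~ c) x).
  case: x => [z|] /=; rewrite ?horner_T // deg_g !coef_T //.
  - exact: (size_fiber_poly f None).
  by rewrite /ratfun_degree; move: (size _) (size _) => a b; lia.
have fib_g v : fiber_poly g v = T (fiber_poly f v).
  by case: v => //= a; rewrite /T rmorphB /= -!mul_polyC rmorphM /= comp_polyC.
split=> // [[z|]|[z|]|x] //=; rewrite ?addrK ?subrK //.
rewrite /ratfun_mult eval_g fib_g; case: x => [z|] /=; last by rewrite deg_g size_T.
by rewrite mup_T // fiber_poly_neq0.
Qed.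
End Translation.

Section Inversion.

(** Substituting 1 / 'X in a form of degree [n] reverses its coefficients. *)
Definition rev_poly n p := \poly_(i < n.+1) p`_(n - i).

Lemma rev_polyK n p : (size p <= n.+1)%N -> rev_poly n (rev_poly n p) = p.
Proof.
move=> sp; apply/polyP=> i; rewrite coef_poly; case: ltnP => [le_in|lt_ni].
  by rewrite coef_poly ltnS leq_subr subKn.
by rewrite nth_default // (leq_trans sp).
Qed.

Lemma rev_poly_neq0 n p : (size p <= n.+1)%N -> p != 0 -> rev_poly n p != 0.
Proof.
move=> sp; apply: contraNneq => rev0; rewrite -(rev_polyK sp) rev0.
by apply/eqP/polyP=> i; rewrite coef_poly !coef0 if_same.
Qed.

Lemma horner_rev_poly n p w : (size p <= n.+1)%N -> w != 0 ->
  (rev_poly n p).[w] = w ^+ n * p.[w^-1].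
Proof.
move=> sp w0; rewrite horner_poly (horner_coef_wide _ sp) mulr_sumr.
rewrite (reindex_inj rev_ord_inj); apply: eq_bigr => i _ /=.
rewrite subSS subKn -1?ltnS // exprVn mulrCA; congr (_ * _).
have wi0 : w ^+ i != 0 by rewrite expf_neq0.
by apply: (mulIf wi0); rewrite divfK // -exprD subnK // -ltnS.
Qed.

Lemma rev_poly_mulXsubC n p a : (size p <= n.+1)%N ->
  rev_poly n.+1 (p * ('X - a%:P)) = rev_poly n p * (1 - a *: 'X).
Proof.
move=> sp; apply/polyP=> i; rewrite [in RHS]mulrBr mulr1 -scalerAr.
rewrite [in RHS]coefB coefZ coefMX.
rewrite !coef_poly mulrBr coefB coefMX coefMC subn_eq0.
case: i => [|i] /=.
  by rewrite mulr0 subr0 !subn0 [p`_n.+1]nth_default // mul0r subr0.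
rewrite subSS ltnS [a * _]mulrC.
have [lt_in|] := ltnP i n.
  by rewrite !ltnS (ltnW lt_in) lt_in leqNgt lt_in subnS.
rewrite leq_eqVlt => /predU1P[<-|lt_ni]; first by rewrite !ltnS leqnn ltnn subnn.
by rewrite !ltnS [(i <= n)%N]leqNgt lt_ni ltnNge (ltnW lt_ni) mul0r subrr.
Qed.

Lemma rev_poly_mulXsubCX n p a e : (size p <= n.+1)%N ->
  rev_poly (n + e) (p * ('X - a%:P) ^+ e) = rev_poly n p * (1 - a *: 'X) ^+ e.
Proof.
move=> sp; elim: e => [|e IHe]; first by rewrite addn0 !expr0 !mulr1.
rewrite addnS !exprSr !mulrA rev_poly_mulXsubC ?IHe //.
rewrite (leq_trans (size_polyMleq _ _)) // size_exp_XsubC.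
by rewrite addnS /= -addSn leq_add2r.
Qed.

Lemma mup_rev_poly n p w : (size p <= n.+1)%N -> p != 0 -> w != 0 ->
  mup w (rev_poly n p) = mup w^-1 p.
Proof.
move=> sp p0 w0; have [e [q]] := multiplicity_XsubC p w^-1; rewrite p0 /= => qw Dp.
have q0 : q != 0 by apply: contraNneq qw => ->; rewrite root0.
have sq : (size q + e <= n.+1)%N.
  have := size_Mmonic q0 (monic_exp e (monicXsubC w^-1)).
  by rewrite -Dp size_exp_XsubC addnS /= => <-.
have e_le : (e <= n)%N by move: sq q0; rewrite -size_poly_gt0; lia.
have {}sq : (size q <= (n - e).+1)%N by move: sq e_le; lia.
have -> : rev_poly n p = (- w^-1) ^+ e *: (rev_poly (n - e) q * ('X - w%:P) ^+ e).
  rewrite Dp -{1}(subnK e_le) rev_poly_mulXsubCX // scalerAr -exprZn.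
  congr (_ * _ ^+ _); rewrite scalerBr !scaleNr opprK -[X in _ = _ + X]mul_polyC.
  by rewrite -polyCM mulVf // addrC.
rewrite -mul_polyC mupMr ?rootC ?expf_neq0 ?oppr_eq0 ?invr_eq0 //.
rewrite Dp !mupMr ?mup_XsubCX ?eqxx // /root horner_rev_poly //.
by rewrite mulf_neq0 ?expf_neq0.
Qed.

(** The order of vanishing at infinity of a form of degree [n] is its degree
    defect as a polynomial. *)
Lemma mup0_rev_poly n p : (size p <= n.+1)%N -> p != 0 ->
  mup 0 (rev_poly n p) = (n - (size p).-1)%N.
Proof.
move=> sp p0; set d := (size p).-1.
have sp1 : size p = d.+1 by rewrite prednK // size_poly_gt0.
have -> : rev_poly n p = rev_poly d p * ('X - 0%:P) ^+ (n - d).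
  have d_le : (d <= n)%N by rewrite -ltnS -sp1.
  rewrite subr0; apply/polyP=> i; rewrite coefMXn !coef_poly.
  have [lt_i|le_i] := ltnP i (n - d).
    by rewrite [p`__]nth_default ?if_same // sp1; move: lt_i; lia.
  have -> : (i - (n - d) < d.+1)%N = (i < n.+1)%N by move: le_i d_le; lia.
  by congr (if _ then _`__ else _); move: le_i d_le; lia.
rewrite mupMr ?mup_XsubCX ?eqxx // /root horner_coef0 coef_poly /= subn0.
by rewrite -lead_coefE lead_coef_eq0.
Qed.

Definition invP1 (x : P1 K) : P1 K :=
  match x with
  | None => Some 0
  | Some z => if z == 0 then None else Some z^-1
  end.

Lemma invP1K : involutive invP1.
Proof.
case=> [z|] /=; last by rewrite eqxx.
by have [->|z0] //= := eqVneq z 0; rewrite invr_eq0 (negPf z0) invrK.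
Qed.

Lemma invert_ratfun f : (0 < ratfun_degree f)%N ->
  exists g, reparametrizes f g invP1 invP1.
Proof.
move=> n_gt0; set n := ratfun_degree f in n_gt0.
have sden : (size (den f) <= n.+1)%N := size_fiber_poly f None.
have snum : (size (num f) <= n.+1)%N.
  by have := size_fiber_poly f (Some 0); rewrite /= scale0r subr0.
have den0 : rev_poly n (den f) != 0.
  by rewrite rev_poly_neq0 // den_neq0.
have coef_rev p : (rev_poly n p)`_n = p.[0].
  by rewrite coef_poly ltnSn subnn horner_coef0.
have horner_rev0 p : (rev_poly n p).[0] = p`_n.
  by rewrite horner_coef0 coef_poly subn0.
have cop : coprimep (rev_poly n (num f)) (rev_poly n (den f)).
  apply: Pdiv.ClosedField.root_coprimep => z; rewrite /root.
  have [->|z0] := eqVneq z 0; last first.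
    rewrite !horner_rev_poly // !mulf_eq0 !expf_eq0 (negPf z0) andbF /=.
    exact: coprimep_root (num_den_coprime f).
  rewrite !horner_rev0 => /eqP num_n.
  by have := ratfun_degree_coef n_gt0; rewrite num_n eqxx.
exists (RatFun den0 cop); set g := RatFun _ _.
have deg_g : ratfun_degree g = n.
  apply: ratfun_degree_eq; rewrite ?size_poly // !coef_rev.
  have [n0|//] := eqVneq (num f).[0] 0.
  by have := coprimep_root (num_den_coprime f) (introT rootP n0); rewrite /= => ->.
have eval_g x : ratfun_eval g x = ratfun_eval f (invP1 x).
  case: x => [z|] /=; last by rewrite deg_g !coef_rev.
  have [->|z0] /= := eqVneq z 0; first by rewrite !horner_rev0.
  rewrite !horner_rev_poly // /mkP1 mulf_eq0 expf_eq0 (negPf z0) andbF /=.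
  by rewrite -mulf_div divff ?mul1r // expf_neq0.
have fib_g v : fiber_poly g v = rev_poly n (fiber_poly f v).
  case: v => //= a; apply/polyP=> i; rewrite coefB coefZ !coef_poly coefB coefZ.
  by case: ifP => //; rewrite mulr0 subr0.
split=> //; try exact: invP1K.
move=> x; rewrite /ratfun_mult eval_g fib_g.
set p := fiber_poly f _; have sp : (size p <= n.+1)%N := size_fiber_poly _ _.
have p0 : p != 0 by exact: fiber_poly_neq0.
case: x @p sp p0 => [z|] /=; last first.
  move=> sp p0; rewrite deg_g -{2}(rev_polyK sp) mup0_rev_poly //.
    exact: size_poly.
  by rewrite rev_poly_neq0.
have [->|z0] /= := eqVneq z 0 => sp p0; first by rewrite mup0_rev_poly.
by rewrite mup_rev_poly.
Qed.

End Inversion.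
End Reparametrization.

Section BelyiExclusion.
Variable K : numClosedFieldType.

(** A finite point is moved to 0 by a translation and then to infinity by an
    inversion. *)
Lemma reparametrize_infinity (f : ratfun K) (x : P1 K) : 0 < ratfun_degree f ->
  exists g M N, reparametrizes f g M N /\ M None = x.
Proof.
move=> n_gt0; case: x => [z|]; last first.
  by exists f, id, id; split=> //; split.
have [f' rep] := translate_ratfun z n_gt0.
have n'_gt0 : 0 < ratfun_degree f' by case: rep => _ _ ->.
have [g rep'] := invert_ratfun n'_gt0.
exists g; do 2 eexists; split; first exact: reparametrizes_trans rep rep'.
by rewrite /= add0r.
Qed.

Theorem no_belyi (f : ratfun K) k l m s : 0 < s -> s <> 5 -> belyi f ->
  ~ belyi_passport f (nseq k 3) (nseq l 2) (nseq m 5 ++ nseq 1 s).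
Proof.
move=> s_gt0 s_neq5 bf [f0 f1 foo]; apply: s_neq5.
have [x fx mx] : exists2 x, ratfun_eval f x = None & ratfun_mult f x = s.
  have [t [_ memt multt]] := foo.
  have : s \in map (ratfun_mult f) t.
    by rewrite (perm_mem multt) mem_cat mem_seq1 eqxx orbT.
  by case/mapP=> x /memt fx ->; exists x.
have [g [M [N [rep Dx]]]] := reparametrize_infinity x (proj1 bf).
have [MN NM dg eg mg] := rep.
have gN : ratfun_eval g None = None by rewrite eg Dx.
have mN : ratfun_mult g None = s by rewrite mg Dx.
have [u [Uu memu multu]] := reparametrizes_fiber rep foo.
have Nu : None \in u by apply/memu.
apply: (belyi_pole_at_infinity s_gt0 (reparametrizes_belyi rep bf)
  (reparametrizes_fiber rep f0) (reparametrizes_fiber rep f1) gN mN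
  (t := rem None u) (m := m)).
- exact: rem_uniq.
- by rewrite mem_rem_uniq // inE eqxx.
- by move=> z; rewrite mem_rem_uniq // inE /= memu.
by apply: perm_map_rem => //; rewrite mN.
Qed.
End BelyiExclusion.

(** * Nonexistence *)

Theorem theorem1 (R : realType) (s : nat) (s_gt0 : 0 < s) (s_neq5 : s <> 5)
    (k l m : nat) :
  (~ exists D : dessin,
       has_genus D 0 /\
       has_passport D (nseq k 3) (nseq l 2) (nseq m 5 ++ nseq 1 s))
  /\
  (~ exists beta : ratfun (complex R),
       belyi beta /\
       belyi_passport beta (nseq k 3) (nseq l 2) (nseq m 5 ++ nseq 1 s)).
Proof.
split=> [[D [genus0 passport]]|[beta [belyi_beta passport]]].
  exact: no_dessin genus0 passport.
exact: no_belyi belyi_beta passport.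
Qed.
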